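(* For every integer $n\geq 2$, let $\beta_n\in(1,2)$ be the $n$-bonacci number, i.e. the number satisfying $\beta^n=\beta^{n-1}+\beta^{n-2}+\cdots+\beta+1$. Then $\dim_H(V_{\beta_n})=1$.
   Context: Let $1<\beta<2$ and $x\in[0,(\beta-1)^{-1}]$. A sequence $(a_k)_{k\ge1}\in\{0,1\}^{\mathbb{N}}$ is a $\beta$-expansion of $x$ if $x=\sum_{k=1}^{\infty}a_k\beta^{-k}$. A $\beta$-expansion $(a_k)$ of $x$ is called universal if for every $m\geq 1$ and every block $b_1b_2\cdots b_m\in\{0,1\}^m$ there exists $k_0$ such that $a_{k_0+1}a_{k_0+2}\cdots a_{k_0+m}=b_1b_2\cdots b_m$. Define $V_\beta=\{x\in[0,(\beta-1)^{-1}]: x \text{ does not have a universal } \beta\text{-expansion}\}$. $\dim_H$ denotes Hausdorff dimension. *)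

(* Defs.v *)
From mathcomp Require Import all_boot all_order all_algebra.
From mathcomp Require Import all_classical all_reals all_analysis.

Set Implicit Arguments.
Unset Strict Implicit.
Unset Printing Implicit Defensive.
Import Order.TTheory GRing.Theory Num.Theory.
Import numFieldNormedType.Exports.

Local Open Scope classical_set_scope.
Local Open Scope ring_scope.

(* The point 0 is added to the set of distances so that the empty set has
   diameter 0; it changes nothing for a nonempty set. *)
Definition diameter (R : realType) (A : set R) : \bar R :=
  ereal_sup (0%E |` [set `|x - y|%:E | x in A & y in A]).

(* Contribution of one covering set. Since [x `^ 0 = 1] (also for [x = 0]),
   the empty set needs its own case for [s = 0], where the outer measure is
   the counting measure. *)
Definition hausdorff_weight (R : realType) (s : R) (A : set R) : \bar R :=
  if A == set0 then 0%E else (diameter A `^ s)%E.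

(* Covers are indexed by [nat]; finite ones are padded with the empty set. *)
Definition delta_cover (R : realType) (delta : R) (A : set R)
    (U : nat -> set R) : Prop :=
  (forall k, (diameter (U k) <= delta%:E)%E) /\ A `<=` \bigcup_k U k.

Definition hausdorff_premeasure (R : realType) (s delta : R) (A : set R) :
    \bar R :=
  ereal_inf [set (\sum_(0 <= k <oo) hausdorff_weight s (U k))%E
            | U in delta_cover delta A].

(* The supremum is the limit as delta decreases to 0. *)
Definition hausdorff_measure (R : realType) (s : R) (A : set R) : \bar R :=
  ereal_sup [set hausdorff_premeasure s delta A
            | delta in [set delta : R | 0 < delta]].

Definition hausdorff_dim (R : realType) (A : set R) : \bar R :=
  ereal_inf [set s%:E
            | s in [set s : R | 0 <= s /\ hausdorff_measure s A = 0%E]].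

(* Digits are indexed from 0: [a k] has weight [beta ^- k.+1]. *)
Definition is_beta_expansion (R : realType) (beta x : R) (a : nat -> bool) :
    Prop :=
  series (fun k => (a k)%:R * beta ^- k.+1) @ \oo --> x.

Definition universal_seq (a : nat -> bool) : Prop :=
  forall (m : nat) (b : m.-tuple bool), (1 <= m)%N ->
    exists k0 : nat, forall i : 'I_m, a (k0 + i)%N = tnth b i.

Definition no_universal_expansion (R : realType) (beta : R) : set R :=
  [set x : R | 0 <= x <= (beta - 1)^-1 /\
    ~ exists a : nat -> bool, is_beta_expansion beta x a /\ universal_seq a].

(* Main.v *)
Require Import Defs.
From mathcomp Require Import all_boot all_order all_algebra.
From mathcomp Require Import all_classical all_reals all_analysis.
From mathcomp Require Import zify ring lra.

Set Implicit Arguments.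
Unset Strict Implicit.
Unset Printing Implicit Defensive.
Import Order.TTheory GRing.Theory Num.Theory.
Import numFieldNormedType.Exports.

Local Open Scope classical_set_scope.
Local Open Scope ring_scope.

(** The upper bound is trivial, as the exceptional set is bounded. For the
lower bound, exceptional points are built from numbers [t] of [0, 1) by diluting
their greedy expansion.

Write [S k a] for the sum of the first [k] digits of [a] with their weights. The
equation of [beta] says that the block [0 1^n] can be replaced by [1 0^n] without
changing the value of an expansion, i.e. that [n] consecutive ones starting
right after the point have value 1. Hence a sequence without [n] consecutive
ones has value at most 1 ([digit_sum_le1]), which makes the lexicographic order
compatible with the order of the values ([digit_sum_after0]).

Suppose that [a] is an expansion of [x] without [n] consecutive ones, and that
every window of [L] digits of [a] contains a one. Then [x] has no universal
expansion ([sparse_expansion_not_universal]). Indeed a universal expansion [b]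
of [x] contains a very long block of zeros, say after its first [k] digits, and
has ones further on. Replacing [0 1^n] by [1 0^n] in the prefix of length [k] as
long as possible gives a word [c] with the same value and without [0 1^n]
([normalise]); these replacements never move a one to the right, so that the long
block of zeros is kept. Thus [x] exceeds [S k c] by a positive but very small
amount. If [S k c <= S k a], then the one that [a] has among the digits
[k, ..., k + L - 1] makes [x] too large. Otherwise [a] is smaller than [c] at
their first disagreement, and then all of [a], whose tail is worth at most
one unit of the preceding digit, has value at most [S k c < x].

Now take the greedy expansion of [t], which has no [n] consecutive ones, and
insert [0 1 0] after each group of [N] digits. The result is an expansion [a] as
above, with [L = N + 3], of a point [sparse_point t]. If two such expansions
first disagree at digit [i], then the next one in the larger of them separates
the values by at least [beta ^- (i + 1 + L)], while the original numbers differ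
by at most about [beta ^- (i * N / (N + 3))]. So [t] is a Hoelder function of
[sparse_point t] with exponent [N / (N + 3)] ([sparse_point_holder]). A cover of
the exceptional set therefore induces a cover of [0, 1) by intervals of length
comparable to [diam ^ s], and the countable subadditivity of Lebesgue measure
bounds the Hausdorff sums from below for [s <= N / (N + 3)]
([hausdorff_measure_holder_neq0]). The exponent tends to 1 with [N]. *)

(** * Hausdorff measure and dimension on the line *)

Lemma diameter_ge0 (R : realType) (A : set R) : (0 <= diameter A)%E.
Proof. by apply: ereal_sup_ubound; left. Qed.

Lemma dist_le_diameter (R : realType) (A : set R) x y : A x -> A y ->
  (`|x - y|%:E <= diameter A)%E.
Proof. by move=> Ax Ay; apply: ereal_sup_ubound; right; exists x => //; exists y. Qed.

Lemma diameter_le (R : realType) (A : set R) (d : R) : 0 <= d ->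
  (forall x y, A x -> A y -> `|x - y| <= d) -> (diameter A <= d%:E)%E.
Proof.
move=> d0 h; apply: ge_ereal_sup => _ [->|[x Ax [y Ay <-]]]; rewrite lee_fin//.
exact: h.
Qed.

Lemma hausdorff_weight_ge0 (R : realType) (s : R) (A : set R) :
  (0 <= hausdorff_weight s A)%E.
Proof. by rewrite /hausdorff_weight; case: ifP => // _; apply: poweR_ge0. Qed.

Lemma hausdorff_weight_le (R : realType) (s d : R) (A : set R) : 0 <= s -> 0 <= d ->
  (forall x y, A x -> A y -> `|x - y| <= d) -> (hausdorff_weight s A <= (d `^ s)%:E)%E.
Proof.
move=> s0 d0 h; rewrite /hausdorff_weight; case: ifP => _.
  by rewrite lee_fin powR_ge0.
rewrite -poweR_EFin gt0_ler_poweR ?in_itv/= ?lee_fin ?diameter_ge0 ?leey ?d0//.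
exact: diameter_le.
Qed.

Lemma hausdorff_premeasure_ge0 (R : realType) (s delta : R) (A : set R) :
  (0 <= hausdorff_premeasure s delta A)%E.
Proof.
by apply: le_ereal_inf_tmp => _ [U _ <-]; apply: nneseries_ge0 => k _ _; exact: hausdorff_weight_ge0.
Qed.

(** Cutting [0, B] into intervals of length [1 / m] costs about
[B * m * m ^- s], which is small for large [m] because [1 < s]. *)
Lemma hausdorff_premeasure_bounded_le (R : realType) (s delta e : R) (A : set R) (B : nat) :
  1 < s -> 0 < delta -> 0 < e -> A `<=` [set x | 0 <= x <= B%:R] ->
  (hausdorff_premeasure s delta A <= e%:E)%E.
Proof.
move=> s1 d0 e0 AB; have s0 : 0 <= s by lra.
pose q : R := B.+1%:R / e; have q0 : 0 < q by rewrite divr_gt0.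
have [m [m0 md mq]] : exists m : nat, [/\ (0 < m)%N, m%:R^-1 <= delta & q <= m%:R `^ (s - 1)].
  (* The three lower bounds for [m]: positivity, mesh size, total cost. *)
  pose y := Num.max 1 (Num.max delta^-1 (q `^ (s - 1)^-1)).
  have y1 : 1 <= y by rewrite le_max lexx.
  have y2 : delta^-1 <= y by rewrite !le_max lexx orbT.
  have y3 : q `^ (s - 1)^-1 <= y by rewrite !le_max lexx !orbT.
  have y0 : 0 <= y by lra.
  have /andP[_ ym] := truncn_itv y0; set m := (Num.trunc y).+1 in ym.
  exists m; split => //.
    rewrite -[delta]invrK lef_pV2 ?posrE ?invr_gt0//; first by apply: le_trans y2 (ltW ym).
  have -> : q = (q `^ (s - 1)^-1) `^ (s - 1).
    by rewrite -powRrM mulVf ?powRr1 ?(ltW q0)//; lra.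
  apply: ge0_ler_powR; rewrite ?nnegrE ?powR_ge0//; first by lra.
  by apply: le_trans y3 (ltW ym).
have mR : 0 < m%:R :> R by rewrite ltr0n.
(* The point [x] is placed in the interval of index [trunc (x * m)], and this
   index is [B * m] when [x] is the right end. *)
pose U (k : nat) : set R := if (k < (B * m).+1)%N then
   [set x | k%:R / m%:R <= x <= k.+1%:R / m%:R] else set0.
have diamU k x y : U k x -> U k y -> `|x - y| <= m%:R^-1.
  rewrite /U; case: ifP => //= _ /andP[x1 x2] /andP[y1 y2].
  rewrite -(natr1 k) mulrDl mul1r in x2 y2; rewrite ler_norml; lra.
have m'0 : 0 <= m%:R^-1 :> R by rewrite invr_ge0 ltW.
apply: ge_ereal_inf; exists (\sum_(0 <= k <oo) hausdorff_weight s (U k))%E.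
  exists U => //; split.
    move=> k; apply: le_trans (diameter_le m'0 (@diamU k)) _; by rewrite lee_fin.
  move=> x /AB /= /andP[x0 xB].
  have xm0 : 0 <= x * m%:R by rewrite mulr_ge0// ltW.
  have /andP[t1 t2] := truncn_itv xm0; set k := Num.trunc _ in t1 t2.
  exists k => //; rewrite /U.
  have -> : (k < (B * m).+1)%N.
    rewrite ltnS -(ler_nat R); apply: le_trans t1 _.
    by rewrite natrM ler_pM2r.
  by rewrite /= ler_pdivrMr// t1 ler_pdivlMr// ltW.
rewrite (nneseries_split 0 (B * m).+1) => [|k _]; last exact: hausdorff_weight_ge0.
rewrite [X in (_ + X)%E]eseries0 ?adde0 => [|k /= km _]; last first.
  by rewrite /hausdorff_weight/U ltnNge add0n in km *; rewrite km eqxx.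
rewrite add0n; apply: (@le_trans _ _ (\sum_(0 <= k < (B * m).+1) (m%:R^-1 `^ s)%:E)%E).
  by apply: lee_sum => k _; apply: hausdorff_weight_le => //; exact: diamU.
rewrite sumEFin lee_fin big_mkord sumr_const card_ord -[leLHS]mulr_natl.
have -> : m%:R^-1 `^ s = m%:R^-1 * (m%:R `^ (s - 1))^-1 :> R.
  rewrite -powR_inv1 ?ltW// -powRrM mulN1r -[in RHS]powRN -powRD; last by rewrite (gt_eqF mR) implybT.
  by congr (_ `^ _); lra.
apply: (@le_trans _ _ ((B.+1 * m)%:R * (m%:R^-1 * (m%:R `^ (s - 1))^-1))).
  by rewrite ler_wpM2r ?mulr_ge0 ?invr_ge0 ?powR_ge0// ler_nat; lia.
rewrite natrM -mulrA mulVKf ?gt_eqF//.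
rewrite ler_pdivrMr ?powR_gt0// mulrC -ler_pdivrMr//.
Qed.

Lemma hausdorff_measure_bounded_eq0 (R : realType) (s : R) (A : set R) (B : nat) :
  1 < s -> A `<=` [set x | 0 <= x <= B%:R] -> hausdorff_measure s A = 0%E.
Proof.
move=> s1 AB; apply/eqP; rewrite eq_le; apply/andP; split.
  apply: ge_ereal_sup => _ [d /= d0 <-]; apply/lee_addgt0Pr => e e0; rewrite add0e.
  exact: (hausdorff_premeasure_bounded_le s1 d0 e0 AB).
apply: le_ereal_sup_tmp; exists (hausdorff_premeasure s 1 A).
  by exists 1 => //=; exact: ltr01.
exact: hausdorff_premeasure_ge0.
Qed.

(** Mass distribution without a measure on [A]: the parameters [t] for which
[f t] lies in a given covering set are at most [C * diam ^ s] apart, so that they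
fit into an interval of length [2 * C * diam ^ s], and these intervals cover
[0, 1). The convention [0 `^ 0 = 1] makes the argument work for [s = 0] too. *)
Lemma hausdorff_measure_holder_neq0 (R : realType) (s C : R) (f : R -> R) (A : set R) :
  0 <= s -> 0 < C -> (forall t : R, 0 <= t < 1 -> A (f t)) ->
  (forall t u : R, 0 <= t < 1 -> 0 <= u < 1 -> `|t - u| <= C * `|f t - f u| `^ s) ->
  hausdorff_measure s A != 0%E.
Proof.
move=> s0 C0 fA fH; rewrite gt_eqF//.
have C20 : 0 < 2 * C by lra.
apply: (@lt_le_trans _ _ ((2 * C)^-1)%:E); first by rewrite lte_fin invr_gt0.
apply: le_ereal_sup_tmp; exists (hausdorff_premeasure s 1 A).
  by exists 1 => //=; exact: ltr01.
apply: le_ereal_inf_tmp => _ [U [Ud AU] <-].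
pose P k (t : R) := 0 <= t < 1 /\ U k (f t).
pose d k := fine (diameter (U k)).
have dE k : diameter (U k) = (d k)%:E.
  rewrite fineK// ge0_fin_numE ?diameter_ge0//.
  by apply: le_lt_trans (Ud k) _; exact: ltry.
pose r k := C * d k `^ s.
(* [I k] is an interval around an arbitrary parameter of the [k]-th set. *)
pose c k : R := xget 0 (P k).
pose I k : set R := if `[< exists t, P k t >] then `[c k - r k, c k + r k]%classic else set0.
have mI k : measurable (I k) by rewrite /I; case: ifP => _; [exact: measurable_itv | exact: measurable0].
have cover : `[0, 1[ `<=` \bigcup_k I k.
  move=> t; rewrite /= in_itv /= => t01.
  have [k _ Uk] := AU _ (fA _ t01); exists k => //.
  have Pt : P k t by [].
  rewrite /I asboolT; last by exists t.
  have [c01 Uc] : P k (c k) by apply: (xgetPex 0); exists t.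
  have : `|t - c k| <= r k.
    apply: le_trans (fH _ _ t01 c01) _; rewrite ler_pM2l//.
    apply: ge0_ler_powR; rewrite ?nnegrE ?normr_ge0//.
      by rewrite -lee_fin -dE diameter_ge0.
    by rewrite -lee_fin -dE; exact: dist_le_diameter.
  rewrite /= in_itv /= ler_norml; lra.
have l01 : lebesgue_measure (`[0:R, 1[%classic) = 1%E.
  by rewrite lebesgue_measure_itv /= lte_fin ltr01 oppr0 adde0.
have le1 : (1 <= \sum_(0 <= k <oo) lebesgue_measure (I k))%E.
  by rewrite -l01; exact: measure_sigma_subadditive.
have le2 : (1 <= (2 * C)%:E * \sum_(0 <= k <oo) hausdorff_weight s (U k))%E.
  apply: le_trans le1 _; rewrite -nneseriesZl => [|k _]; last exact: hausdorff_weight_ge0.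
  apply: lee_nneseries => [k _ _|k _]; first exact: measure_ge0.
  rewrite /I; case: asboolP => [[t [t01 Ut]]|_]; last first.
    by rewrite measure0 mule_ge0 ?hausdorff_weight_ge0// lee_fin ltW.
  rewrite /hausdorff_weight ifF; last by apply/negP => /eqP U0; rewrite U0 in Ut.
  rewrite dE poweR_EFin -EFinM lebesgue_measure_itv /= lte_fin.
  case: ifP => _; rewrite ?lee_fin; last by rewrite mulr_ge0 ?powR_ge0// ltW.
  rewrite /r; lra.
by rewrite -[leLHS]mule1 lee_pdivrMl.
Qed.

Lemma hausdorff_dim_eq1 (R : realType) (A : set R) (B : nat) :
  A `<=` [set x | 0 <= x <= B%:R] ->
  (forall s, 0 <= s < 1 -> hausdorff_measure s A != 0%E) ->
  hausdorff_dim A = 1%E.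
Proof.
move=> AB low; apply/eqP; rewrite eq_le; apply/andP; split.
  apply/lee_addgt0Pr => e e0; apply: ereal_inf_lbound; exists (1 + e) => //; split; first by lra.
  by apply: hausdorff_measure_bounded_eq0 AB; lra.
apply: le_ereal_inf_tmp => _ [s [s0 hs] <-]; rewrite lee_fin leNgt; apply/negP => s1.
by have := low s; rewrite hs eqxx s0 s1 => /(_ isT).
Qed.

(** * Finite digit sums in base beta *)

Definition digit_sum (R : realType) (beta : R) (a : nat -> bool) (k : nat) : R :=
  \sum_(j < k) (a j)%:R * beta ^- j.+1.

Definition tail_seq (p : nat) (a : nat -> bool) : nat -> bool :=
  fun j => a (p + j)%N.

Definition no_run (n : nat) (a : nat -> bool) : Prop :=
  forall i, exists2 j, (j < n)%N & ~~ a (i + j)%N.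

Lemma digit_sumS (R : realType) (beta : R) a k :
  digit_sum beta a k.+1 = digit_sum beta a k + (a k)%:R * beta ^- k.+1.
Proof. by rewrite /digit_sum big_ord_recr. Qed.

Lemma digit_sumD (R : realType) (beta : R) a p m :
  digit_sum beta a (p + m)
    = digit_sum beta a p + beta ^- p * digit_sum beta (tail_seq p a) m.
Proof.
rewrite /digit_sum big_split_ord /= mulr_sumr; congr (_ + _).
apply: eq_bigr => j _; rewrite /tail_seq -addnS exprD invfM; ring.
Qed.

Lemma eq_digit_sum (R : realType) (beta : R) a b k :
  (forall j, (j < k)%N -> a j = b j) -> digit_sum beta a k = digit_sum beta b k.
Proof. by move=> e; apply: eq_bigr => j _; rewrite e. Qed.

Lemma digit_sum_ge0 (R : realType) (beta : R) a k :
  0 < beta -> 0 <= digit_sum beta a k.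
Proof.
move=> b0; apply: sumr_ge0 => j _.
by rewrite mulr_ge0 ?ler0n// invr_ge0 exprn_ge0// ltW.
Qed.

Lemma digit_sum_homo (R : realType) (beta : R) a :
  0 < beta -> {homo digit_sum beta a : i j / (i <= j)%N >-> i <= j}.
Proof.
move=> b0 i j /subnKC <-; rewrite digit_sumD lerDl.
by rewrite mulr_ge0 ?digit_sum_ge0// invr_ge0 exprn_ge0// ltW.
Qed.

Lemma no_run_tail n p a : no_run n a -> no_run n (tail_seq p a).
Proof. by move=> na i; have [j jn] := na (p + i)%N; exists j; rewrite // /tail_seq addnA. Qed.

(** The defining equation of [beta], divided by [beta ^+ n]: a one weighs as
much as the [n] ones that follow it. *)
Lemma sum_inv_powers (R : realType) (n : nat) (beta : R) : beta != 0 ->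
  beta ^+ n = \sum_(i < n) beta ^+ i -> digit_sum beta xpredT n = 1.
Proof.
move=> b0 hroot; apply: (mulfI (expf_neq0 n b0)).
rewrite mulr1 {2}hroot (reindex_inj rev_ord_inj) /= /digit_sum mulr_sumr.
apply: eq_bigr => j _; rewrite mul1r -{1}(subnK (ltn_ord j)) exprD.
by rewrite mulfK ?expf_neq0.
Qed.

(** Cut the sequence after its first zero, at position [l < n]. By induction
the tail is worth at most one digit at position [l]; replacing that zero by a
one leaves at most [n] ones, of total value at most 1. *)
Lemma digit_sum_le1 (R : realType) (n : nat) (beta : R) a m : 0 < beta ->
  digit_sum beta xpredT n = 1 -> no_run n a -> digit_sum beta a m <= 1.
Proof.
move=> b0 h1; elim/ltn_ind: m a => m IH a na.
have [j0 j0n aj0] := na 0; rewrite add0n in aj0.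
have exl : exists j, ~~ a j by exists j0.
case: (ex_minnP exl) => l al lmin.
have ln : (l < n)%N by apply: leq_ltn_trans j0n; apply: lmin.
have ones j : (j < l)%N -> a j = xpredT j.
  by move=> jl; apply/negPn/negP => /lmin; rewrite leqNgt jl.
have prefix k : (k <= l)%N -> digit_sum beta a k = digit_sum beta xpredT k.
  by move=> kl; apply: eq_digit_sum => j /leq_trans/(_ kl); exact: ones.
have [ml|lm] := leqP m l.
  by rewrite prefix// -h1; apply: digit_sum_homo => //; apply: ltnW; apply: leq_ltn_trans ln.
rewrite -(subnKC lm) digit_sumD digit_sumS prefix// (negbTE al) mul0r addr0.
have := digit_sum_homo xpredT b0 ln; rewrite h1; apply: le_trans.
rewrite digit_sumS lerD2l mul1r ler_piMr ?invr_ge0 ?exprn_ge0 ?(ltW b0)//.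
by apply: IH; [lia | exact: no_run_tail].
Qed.

Lemma first_disagreement (u v : nat -> bool) k : u k != v k ->
  exists i, [/\ (i <= k)%N, u i != v i & forall j, (j < i)%N -> u j = v j].
Proof.
move=> dk; have ex : exists k, u k != v k by exists k.
case: (ex_minnP ex) => i di imin; exists i; split => //; first exact: imin.
by move=> j ji; apply/eqP/negPn/negP => /imin; rewrite leqNgt ji.
Qed.

(** A zero at position [i] caps the whole sequence by what a one at position
[i], followed by zeros, would give: this is how lexicographic comparison yields
comparison of values. *)
Lemma digit_sum_after0 (R : realType) (n : nat) (beta : R) v i k : 0 < beta ->
  digit_sum beta xpredT n = 1 -> ~~ v i -> no_run n (tail_seq i.+1 v) ->
  digit_sum beta v k <= digit_sum beta v i + beta ^- i.+1.
Proof.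
move=> b0 h1 vi nv; have bi : 0 <= beta ^- i.+1 by rewrite invr_ge0 exprn_ge0// ltW.
have [ki|ik] := leqP k i.
  by apply: (le_trans (digit_sum_homo v b0 ki)); rewrite lerDl.
rewrite -(subnKC ik) digit_sumD digit_sumS (negbTE vi) mul0r addr0 lerD2l.
by rewrite ler_piMr// (digit_sum_le1 _ b0 h1).
Qed.

(** If no zero is followed by [n] ones, then behind a given zero there is no
run of [n] ones at all: walk back from the run to the last zero before it. *)
Lemma no_run_after (n i : nat) c : ~~ c i ->
  (forall i, ~~ c i -> exists2 j, (j < n)%N & ~~ c (i.+1 + j)%N) ->
  no_run n (tail_seq i.+1 c).
Proof.
move=> ci h; elim=> [|p IH]; rewrite /tail_seq.
  by have [j] := h i ci; exists j.
have [cp|cp] := boolP (c (i.+1 + p)%N); last first.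
  by have [j jn cj] := h _ cp; exists j => //; have -> : (i.+1 + (p.+1 + j) = (i.+1 + p).+1 + j)%N by lia.
have [[|j] jn] := IH; rewrite /tail_seq ?addn0 ?cp// => cj.
exists j; first exact: ltnW.
by have -> : (i.+1 + (p.+1 + j) = i.+1 + (p + j.+1))%N by lia.
Qed.

(** Rewrite [0 1^n] into [1 0^n] in the word formed by the first [k] digits,
until this is no longer possible. It terminates because [1 < n] makes the number
of ones decrease, and the word keeps its length because no digit 1 moves to
the right. A run of [n] ones may survive at the very beginning, where no zero
precedes it. *)
Lemma normalise (R : realType) (n : nat) (beta : R) k b : 0 < beta ->
  (1 < n)%N -> digit_sum beta xpredT n = 1 ->
  exists2 c, digit_sum beta c k = digit_sum beta b k
    & forall i, ~~ c i -> exists2 j, (j < n)%N & ~~ c (i.+1 + j)%N.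
Proof.
move=> b0 n1 h1.
(* Truncation by zeros turns the prefix into a sequence, so that blocks that
   stick out of the prefix cannot occur. *)
pose b' j := (j < k)%N && b j.
have -> : digit_sum beta b k = digit_sum beta b' k.
  by apply: eq_digit_sum => j jk; rewrite /b' jk.
have : forall j, (k <= j)%N -> ~~ b' j by move=> j; rewrite /b' ltnNge => ->.
move: b' => {}b; have [w] := ubnP (\sum_(j < k) b j)%N.
elim: w b => // w IH b wb bk.
have [good|] := pselect (forall i, ~~ b i -> exists2 j, (j < n)%N & ~~ b (i.+1 + j)%N).
  by exists b.
move=> /existsNP[i /not_implyP[bi /forall2NP run]].
have {}run j : (i < j <= i + n)%N -> b j.
  move=> /andP[ij jn]; have [] := run (j - i.+1)%N; first by lia.
  by rewrite subnKC// => /negP/negPn.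
have ink : (i + n < k)%N.
  by rewrite ltnNge; apply/negP => /bk; rewrite run//; lia.
pose c j := if (i <= j <= i + n)%N then j == i else b j.
have cb j : (j < i)%N || (i + n < j)%N -> c j = b j.
  by rewrite /c; case: ifP => //; lia.
suff [cS cw] : digit_sum beta c k = digit_sum beta b k /\ (\sum_(j < k) c j < \sum_(j < k) b j)%N.
  rewrite -cS; apply: IH; first by lia.
  by move=> j kj; rewrite cb ?bk//; lia.
(* Only the [n.+1] digits starting at position [i] change. *)
have kE : k = (i + n.+1 + (k - (i + n.+1)))%N by lia.
split.
  rewrite kE !(digit_sumD _ _ (i + n.+1)); congr (_ + _ * _); last first.
    by apply: eq_digit_sum => j _; rewrite /tail_seq cb//; lia.
  rewrite !digit_sumD; congr (_ + _ * _).
    by apply: eq_digit_sum => j ji; rewrite cb// ji.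
  have dS a : digit_sum beta a n.+1 = (a 0)%:R * beta^-1 + beta^-1 * digit_sum beta (tail_seq 1 a) n.
    by rewrite -(add1n n) digit_sumD digit_sumS {1}/digit_sum big_ord0 add0r expr1.
  rewrite !dS /tail_seq addn0 (negbTE bi) (@eq_digit_sum _ _ _ xpred0 n); last first.
    by move=> j jn; rewrite /c; case: ifP => //; lia.
  rewrite (@eq_digit_sum _ _ (fun j => b (i + _)%N) xpredT n); last first.
    by move=> j jn; rewrite run//; lia.
  rewrite h1 /c leqnn leq_addr eqxx /digit_sum big1 => [|j _]; last by rewrite mul0r.
  rewrite /=; ring.
rewrite kE !big_split_ord /= -addnA -addnA.
have -> : (\sum_(j < i) c j = \sum_(j < i) b j)%N.
  by apply: eq_bigr => j _; rewrite cb// ltn_ord.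
rewrite ltn_add2l; set e := (X in (_ + X)%N); set f := (X in (_ < _ + X)%N).
have -> : e = f by apply: eq_bigr => j _; rewrite cb//; lia.
rewrite ltn_add2r !big_ord_recl /= !addn0 (negbTE bi) add0n.
rewrite (eq_bigr (fun=> 0%N)) => [|j _]; last first.
  by rewrite /c /bump /=; case: ifP; have := ltn_ord j; lia.
rewrite [in ltnRHS](eq_bigr (fun=> 1%N)) => [|j _]; last first.
  by rewrite run// /bump /=; have := ltn_ord j; lia.
rewrite !sum_nat_const card_ord muln0 addn0 muln1 /c leqnn leq_addr eqxx //.
Qed.

(** * Expansions and their values *)

Lemma series_digit_sum (R : realType) (beta : R) (a : nat -> bool) :
  series (fun k => (a k)%:R * beta ^- k.+1) = digit_sum beta a.
Proof. by rewrite seriesEord. Qed.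

Lemma expansion_ge (R : realType) (beta x : R) (a : nat -> bool) k :
  0 < beta -> is_beta_expansion beta x a -> digit_sum beta a k <= x.
Proof.
rewrite /is_beta_expansion series_digit_sum => b0 ax; rewrite -(cvg_lim _ ax)//.
by apply: nondecreasing_cvgn_le; [exact: digit_sum_homo | exact: cvgP ax].
Qed.

Lemma expansion_le (R : realType) (beta x M : R) (a : nat -> bool) :
  is_beta_expansion beta x a -> (forall k, digit_sum beta a k <= M) -> x <= M.
Proof.
rewrite /is_beta_expansion series_digit_sum => ax aM; rewrite -(cvg_lim _ ax)//.
by apply: limr_le; [exact: cvgP ax | exact: nearW].
Qed.

Lemma bounded_expansion (R : realType) (beta M : R) (a : nat -> bool) :
  0 < beta -> (forall k, digit_sum beta a k <= M) ->
  is_beta_expansion beta (limn (digit_sum beta a)) a.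
Proof.
move=> b0 aM; rewrite /is_beta_expansion series_digit_sum.
apply: nondecreasing_is_cvgn; first exact: digit_sum_homo.
by exists M => _ [k _ <-].
Qed.

Lemma digit_sum_one_ge (R : realType) (beta : R) (a : nat -> bool) (j L : nat) : 1 < beta -> (j < L)%N ->
  a j -> beta ^- L <= digit_sum beta a L.
Proof.
move=> b1 jL aj; have b0 : 0 < beta by lra.
apply: le_trans (digit_sum_homo a b0 jL); rewrite digit_sumS aj mul1r.
apply: (@le_trans _ _ (beta ^- j.+1)); last by rewrite lerDr digit_sum_ge0.
by rewrite lef_pV2 ?posrE ?exprn_gt0// ler_weXn2l// ltW.
Qed.

Lemma mul_digit_sum_ones (R : realType) (beta : R) m : beta != 0 ->
  (beta - 1) * digit_sum beta xpredT m = 1 - beta ^- m.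
Proof.
move=> b0; elim: m => [|m IH].
  by rewrite /digit_sum big_ord0 mulr0 expr0 invr1 subrr.
by rewrite digit_sumS mulrDr IH mul1r exprS; field; rewrite expf_neq0.
Qed.

(** The sums are bounded by [(beta - 1)^-1 = beta ^+ n / (beta ^+ n - 1)], and
[beta ^+ n >= n >= 2] because it is a sum of [n] terms at least 1. *)
Lemma digit_sum_ones_le (R : realType) (n : nat) (beta : R) m : 1 < beta -> (1 < n)%N ->
  beta ^+ n = \sum_(i < n) beta ^+ i -> digit_sum beta xpredT m <= beta ^+ n.
Proof.
move=> b1 n1 hroot; have b0 : beta != 0 by apply: lt0r_neq0; lra.
have bm : 0 <= beta ^- m by rewrite invr_ge0 exprn_ge0//; lra.
have bn : 2 <= beta ^+ n.
  apply: (@le_trans _ _ n%:R); first by rewrite ler_nat.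
  rewrite hroot -[n in n%:R]card_ord -sumr_const; apply: ler_sum => i _.
  by rewrite exprn_ege1// ltW.
have := mul_digit_sum_ones n b0; rewrite (sum_inv_powers b0 hroot) mulr1 => bE.
have bbn : (beta - 1) * beta ^+ n = beta ^+ n - 1.
  by rewrite bE mulrBl mul1r mulVf// expf_neq0.
have b10 : 0 < beta - 1 by lra.
rewrite -(ler_pM2l b10) mul_digit_sum_ones// bbn; lra.
Qed.

(** * Expansions with bounded gaps and no long runs *)

(** A universal expansion [b] has a block of [M] zeros after some position [k]
and a one further on, so that [x] lies slightly above the value of the first [k]
digits of [b]. Comparing [a] with the normal form [c] of this prefix excludes
both orders of the two prefixes. *)
Lemma sparse_expansion_not_universal (R : realType) (n L p : nat) (beta x : R) (a : nat -> bool) :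
  1 < beta -> (1 < n)%N -> digit_sum beta xpredT n = 1 ->
  (forall m, digit_sum beta xpredT m <= beta ^+ p) ->
  no_run n a -> (forall k, exists2 j, (j < L)%N & a (k + j)%N) ->
  is_beta_expansion beta x a ->
  ~ exists b, is_beta_expansion beta x b /\ universal_seq b.
Proof.
move=> b1 n1 h1 hp na da ax [b [bx bu]]; have b0 : 0 < beta by lra.
have pos i : 0 < beta ^- i by rewrite invr_gt0 exprn_gt0.
(* A tail after [L + p.+1] zeros is worth at most [beta ^- L.+1]; the extra
   factor [beta] makes the comparison with [beta ^- L] strict. *)
pose M := (L + p.+1)%N.
have [k bk] := bu M (nseq_tuple M false) (ltn_addl _ (ltn0Sn _)).
have {}bk i : (i < M)%N -> b (k + i)%N = false.
  by move=> iM; rewrite (bk (Ordinal iM)) tnth_nseq.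
(* A block of [k.+1] ones must end at or after position [k]. *)
have [k1 bk1] := bu k.+1 (nseq_tuple k.+1 true) isT.
have {}bk1 : b (k1 + k)%N by rewrite (bk1 ord_max) tnth_nseq.
have [c cb nc] := normalise k b b0 n1 h1.
have [ca|ac] := leP (digit_sum beta c k) (digit_sum beta a k).
  (* The next one of [a] is worth more than everything [b] has left. *)
  have xle : x <= digit_sum beta b k + beta ^- k * (beta ^- M * beta ^+ p).
    apply: expansion_le bx _ => m.
    apply: (le_trans (digit_sum_homo b b0 (leq_addl (k + M) m))).
    rewrite -addnA digit_sumD lerD2l ler_wpM2l ?(ltW (pos _))// digit_sumD.
    have -> : digit_sum beta (tail_seq k b) M = 0.
      by rewrite /digit_sum big1// => i _; rewrite /tail_seq bk ?mul0r.
    rewrite add0r ler_wpM2l ?(ltW (pos _))//; apply: le_trans (hp m).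
    apply: ler_sum => i _; rewrite ler_wpM2r ?(ltW (pos _))//; by case: (tail_seq _ _ _).
  have xge := expansion_ge (k + L) b0 ax; rewrite digit_sumD in xge.
  have [j jL aj] := da k.
  have aL : beta ^- L <= digit_sum beta (tail_seq k a) L by exact: digit_sum_one_ge jL aj.
  have : beta ^- M * beta ^+ p < beta ^- L.
    rewrite /M exprD exprS !invfM mulrA mulfVK ?expf_neq0 ?gt_eqF//.
    by rewrite gtr_pMr// invf_lt1.
  rewrite -(ltr_pM2l (pos k)); have := ler_wpM2l (ltW (pos k)) aL.
  lra.
have [i [ik di ei]] : exists i, [/\ (i < k)%N, a i != c i & forall j, (j < i)%N -> a j = c j].
  have [j /andP[jk dj]] : exists j, (j < k)%N && (a j != c j).
    apply: contrapT => /forallNP e; move: ac; rewrite (@eq_digit_sum _ _ a c) ?ltxx//.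
    by move=> j jk; apply/eqP/negPn/negP => d; apply: (e j); rewrite jk.
  have [i [ij di ei]] := @first_disagreement a c j dj; exists i; split => //.
  exact: leq_ltn_trans ij jk.
have Si := eq_digit_sum beta ei.
have [ai|ai] := boolP (a i).
  have ci : ~~ c i by move: di; rewrite ai; case: (c i).
  have := digit_sum_after0 k b0 h1 ci (no_run_after ci nc).
  have := digit_sum_homo a b0 ik; rewrite digit_sumS ai mul1r; lra.
(* At the first disagreement [a] has a zero and [c] a one, so that all of [a]
   is worth at most a prefix of [b], although [b] has a further one. *)
have ci : c i by move: di; rewrite (negbTE ai); case: (c i).
have xle : x <= digit_sum beta b k.
  rewrite -cb; apply: expansion_le ax _ => m.
  have := digit_sum_after0 m b0 h1 ai (no_run_tail _ na).
  have := digit_sum_homo c b0 ik; rewrite digit_sumS ci mul1r; lra.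
have := expansion_ge (k1 + k).+1 b0 bx; rewrite digit_sumS bk1 mul1r.
have := digit_sum_homo b b0 (leq_addl k1 k); have := pos (k1 + k).+1; lra.
Qed.

(** Behind the first disagreement the smaller sequence gains at most the
missing digit, while the larger one gains a further one within [L] digits. *)
Lemma expansion_sep (R : realType) (n L : nat) (beta x y : R) (u v : nat -> bool) (i : nat) :
  1 < beta -> digit_sum beta xpredT n = 1 -> no_run n v ->
  (forall k, exists2 j, (j < L)%N & u (k + j)%N) ->
  is_beta_expansion beta x u -> is_beta_expansion beta y v ->
  (forall j, (j < i)%N -> u j = v j) -> u i -> ~~ v i ->
  beta ^- (i.+1 + L) <= x - y.
Proof.
move=> b1 h1 nv du ux vy e ui vi; have b0 : 0 < beta by lra.
have yle : y <= digit_sum beta v i + beta ^- i.+1.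
  by apply: expansion_le vy _ => m; apply: (digit_sum_after0 _ b0 h1) => //; exact: no_run_tail.
have := expansion_ge (i.+1 + L) b0 ux; rewrite digit_sumD digit_sumS ui mul1r (eq_digit_sum beta e).
have [j jL uj] := du i.+1.
have uL : beta ^- L <= digit_sum beta (tail_seq i.+1 u) L by exact: digit_sum_one_ge jL uj.
have : beta ^- i.+1 * beta ^- L <= beta ^- i.+1 * digit_sum beta (tail_seq i.+1 u) L.
  by rewrite ler_wpM2l// invr_ge0 exprn_ge0// ltW.
rewrite exprD invfM; lra.
Qed.

(** * Dilution of a digit sequence *)

(** The one guarantees bounded gaps; the zeros around it prevent it from
extending a run of ones. *)
Definition insert_010 (N : nat) (z : nat -> bool) (i : nat) : bool :=
  let r := (i %% (N + 3))%N in
  if (r < N)%N then z (i %/ (N + 3) * N + r)%N else r == N.+1.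

Lemma insert_010E N z q r : (r < N + 3)%N ->
  insert_010 N z (q * (N + 3) + r) = if (r < N)%N then z (q * N + r)%N else r == N.+1.
Proof.
move=> rN; rewrite /insert_010 modnMDl modn_small// divnMDl ?addn3//.
by rewrite -addn3 divn_small// addn0.
Qed.

Lemma insert_010_no_run n N z : (1 < n)%N -> no_run n z -> no_run n (insert_010 N z).
Proof.
move=> n1 nz i; apply: contrapT => /forall2NP run.
have {}run j : (j < n)%N -> insert_010 N z (i + j)%N.
  by move=> jn; have [//|/negP/negPn] := run j.
have L0 : (0 < N + 3)%N by rewrite addn3.
move: run; rewrite (divn_eq i (N + 3)); have := ltn_pmod i L0.
move: (i %% _)%N (i %/ _)%N => r q rL run.
have rN j : (j < n)%N -> (r + j < N)%N.
  elim: j => [_|j IH jn].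
    have := run 0 (ltnW n1); rewrite !addn0 insert_010E//; case: ifP => // _ /eqP rE.
    by have := run 1 n1; rewrite -addnA insert_010E; [case: ifP => [|_ /eqP]; lia | lia].
  have := run j.+1 jn; have := IH (ltnW jn) => rj.
  by rewrite -addnA insert_010E; [case: ifP => [//|_ /eqP]; lia | lia].
have [j jn] := nz (q * N + r)%N; have := run j jn.
rewrite -addnA insert_010E; last by have := rN j jn; lia.
by rewrite rN// addnA => ->.
Qed.

Lemma insert_010_dense N z k : exists2 j, (j < N + 3)%N & insert_010 N z (k + j).
Proof.
have L0 : (0 < N + 3)%N by rewrite addn3.
rewrite (divn_eq k (N + 3)); have := ltn_pmod k L0.
move: (k %% _)%N (k %/ _)%N => r q rL.
have hit q' : insert_010 N z (q' * (N + 3) + N.+1).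
  by rewrite insert_010E ?ltnNge ?leqnSn ?eqxx//; lia.
have [rN|rN] := leqP r N.+1.
  exists (N.+1 - r)%N; first by lia.
  by rewrite -addnA subnKC.
exists N.+2; first by lia.
have -> : (q * (N + 3) + r + N.+2 = q.+1 * (N + 3) + N.+1)%N by rewrite mulSn; lia.
exact: hit.
Qed.

(** Digit [p] of the original moves to position
[p %/ N * (N + 3) + p %% N], and what precedes it depends only on the first [p]
original digits. *)
Lemma insert_010_agree N z z' p : (0 < N)%N ->
  (forall j, (j < p)%N -> z j = z' j) ->
  let i := (p %/ N * (N + 3) + p %% N)%N in
  (forall j, (j < i)%N -> insert_010 N z j = insert_010 N z' j) /\
  insert_010 N z i = z p /\ insert_010 N z' i = z' p.
Proof.
move=> N0 e i; have rN := ltn_pmod p N0.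
have rN3 : (p %% N < N + 3)%N by lia.
split; last by rewrite !insert_010E// rN -divn_eq.
move=> j; rewrite /i (divn_eq j (N + 3)).
have L0 : (0 < N + 3)%N by rewrite addn3.
have := ltn_pmod j L0; move: (j %% _)%N (j %/ _)%N => r' q' rL ji.
rewrite !insert_010E//; case: ifP => // r'N; apply: e.
rewrite (divn_eq p N); move: (p %% N)%N (p %/ N)%N rN {rN3} ji => r q rN ji.
have [qq|qq|qq] := ltngtP q' q.
- by have := leq_mul2r N q'.+1 q; rewrite mulSn; lia.
- by have := leq_mul2r (N + 3) q.+1 q'; rewrite mulSn; lia.
- by rewrite qq in ji *; lia.
Qed.

(** * Greedy expansions *)

Definition greedy_rem (R : realType) (beta t : R) (k : nat) : R :=
  iter k (fun r => beta * r - (1 <= beta * r)%R%:R) t.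

Definition greedy (R : realType) (beta t : R) (k : nat) : bool :=
  1 <= beta * greedy_rem beta t k.

Lemma greedy_rem_itv (R : realType) (beta t : R) k : 1 < beta < 2 ->
  0 <= t < 1 -> 0 <= greedy_rem beta t k < 1.
Proof.
move=> b12 t01; elim: k => [//|k]; rewrite /greedy_rem iterS.
move: (iter _ _ _) => r /andP[r0 r1].
have br0 : 0 <= beta * r by rewrite mulr_ge0//; lra.
have br2 : beta * r < 2 by nra.
have [h|h] := leP 1 (beta * r); rewrite ?mulr1n ?mulr0n; lra.
Qed.

Lemma greedyE (R : realType) (beta t : R) k : 0 < beta ->
  t = digit_sum beta (greedy beta t) k + beta ^- k * greedy_rem beta t k.
Proof.
move=> b0; elim: k => [|k IH].
  by rewrite /digit_sum big_ord0 add0r expr0 invr1 mul1r.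
rewrite {1}IH digit_sumS -addrA; congr (_ + _).
rewrite /greedy_rem iterS -/(greedy_rem beta t k) -/(greedy beta t k) exprS.
by field; rewrite expf_neq0 ?gt_eqF.
Qed.

Lemma greedyD (R : realType) (beta t : R) i j :
  greedy beta t (i + j) = greedy beta (greedy_rem beta t i) j.
Proof. by rewrite /greedy /greedy_rem addnC iterD. Qed.

(** A run of [n] ones starting at position [i] would make the [i]-th remainder
at least 1. *)
Lemma greedy_no_run (R : realType) (n : nat) (beta t : R) : 1 < beta < 2 ->
  digit_sum beta xpredT n = 1 -> 0 <= t < 1 -> no_run n (greedy beta t).
Proof.
move=> b12 h1 t01 i; apply: contrapT => /forall2NP run.
have b0 : 0 < beta by lra.
have /andP[_] := greedy_rem_itv i b12 t01; rewrite ltNge => /negP; apply.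
rewrite (greedyE (greedy_rem beta t i) n b0) (@eq_digit_sum _ _ _ xpredT) => [|j jn].
  rewrite h1 lerDl mulr_ge0 ?invr_ge0 ?exprn_ge0 ?(ltW b0)//.
  by have /andP[] := greedy_rem_itv n b12 (greedy_rem_itv i b12 t01).
by rewrite -greedyD; have [//|/negP/negPn ->] := run j.
Qed.

Lemma greedy_dist (R : realType) (beta t u : R) k : 1 < beta < 2 ->
  0 <= t < 1 -> 0 <= u < 1 ->
  (forall j, (j < k)%N -> greedy beta t j = greedy beta u j) -> `|t - u| <= beta ^- k.
Proof.
move=> b12 t01 u01 e; have b0 : 0 < beta by lra.
have -> : t - u = beta ^- k * (greedy_rem beta t k - greedy_rem beta u k).
  by rewrite {1}(greedyE t k b0) {1}(greedyE u k b0) (eq_digit_sum beta e); ring.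
have bk : 0 <= beta ^- k by rewrite invr_ge0 exprn_ge0// ltW.
rewrite normrM ger0_norm// ler_piMr// ler_norml.
have := greedy_rem_itv k b12 t01; have := greedy_rem_itv k b12 u01; lra.
Qed.

Lemma greedy_inj (R : realType) (beta t u : R) : 1 < beta < 2 ->
  0 <= t < 1 -> 0 <= u < 1 -> t != u -> exists k, greedy beta t k != greedy beta u k.
Proof.
move=> b12 t01 u01 tu; apply: contrapT => /forallNP e.
have /(cvg_expr (R := R)) cv0 : `|beta^-1| < 1.
  by rewrite ger0_norm ?invr_ge0 ?invf_lt1; lra.
move/negP: tu; apply; rewrite -subr_eq0 -normr_le0 -(cvg_lim _ cv0)//.
apply: limr_ge; first exact: cvgP cv0.
apply: nearW => k; rewrite exprVn; apply: greedy_dist => // j _.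
by apply/eqP/negPn/negP; exact: e.
Qed.

(** * The diluted points *)

Lemma powR_ratio (R : realType) (beta s : R) (N L k : nat) : 1 < beta ->
  s * L%:R <= N%:R -> beta ^- (k * N) <= (beta ^- (k * L)) `^ s.
Proof.
move=> b1 sLN; have b0 : 0 <= beta by lra.
rewrite -!powR_invn// -powRrM ler_powR ?(ltW b1)// mulNr lerN2 !natrM -mulrA.
by rewrite ler_wpM2l// mulrC.
Qed.

Definition sparse_point (R : realType) (beta : R) (N : nat) (t : R) : R :=
  limn (digit_sum beta (insert_010 N (greedy beta t))).

Lemma sparse_point_expansion (R : realType) (n N : nat) (beta t : R) :
  1 < beta < 2 -> (1 < n)%N -> digit_sum beta xpredT n = 1 -> 0 <= t < 1 ->
  is_beta_expansion beta (sparse_point beta N t) (insert_010 N (greedy beta t)).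
Proof.
move=> b12 n1 h1 t01; have b0 : 0 < beta by lra.
apply: (@bounded_expansion _ _ 1) => // k; apply: (digit_sum_le1 _ b0 h1).
by apply: insert_010_no_run => //; exact: greedy_no_run.
Qed.

Lemma sparse_point_no_universal (R : realType) (n N : nat) (beta t : R) :
  1 < beta < 2 -> (1 < n)%N -> beta ^+ n = \sum_(i < n) beta ^+ i -> 0 <= t < 1 ->
  no_universal_expansion beta (sparse_point beta N t).
Proof.
move=> b12 n1 hroot t01; have b0 : 0 < beta by lra.
have b1 : 1 < beta by lra.
have h1 := sum_inv_powers (lt0r_neq0 b0) hroot.
have ex := @sparse_point_expansion _ n N _ _ b12 n1 h1 t01.
have nr := @insert_010_no_run n N _ n1 (greedy_no_run b12 h1 t01).
split; last first.
  apply: (sparse_expansion_not_universal (p := n) b1 n1 h1 _ nr (insert_010_dense N _) ex) => m.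
  exact: (digit_sum_ones_le m b1 n1 hroot).
apply/andP; split.
  by have := expansion_ge 0 b0 ex; rewrite /digit_sum big_ord0.
apply: (@le_trans _ _ 1); last by rewrite invf_ge1; lra.
by apply: expansion_le ex _ => m; exact: digit_sum_le1 nr.
Qed.

Lemma sparse_point_holder (R : realType) (n N : nat) (beta s t u : R) :
  1 < beta < 2 -> (1 < n)%N -> digit_sum beta xpredT n = 1 -> (0 < N)%N ->
  0 <= s -> s * (N + 3)%:R <= N%:R -> 0 <= t < 1 -> 0 <= u < 1 ->
  `|t - u| <= beta ^+ (2 * N) * `|sparse_point beta N t - sparse_point beta N u| `^ s.
Proof.
move=> b12 n1 h1 N0 s0 sN t01 u01; have b0 : 0 < beta by lra.
have b1 : 1 < beta by lra.
have [->|tu] := eqVneq t u.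
  by rewrite !subrr normr0 mulr_ge0 ?powR_ge0 ?exprn_ge0 ?ltW.
have [k0 dk] := greedy_inj b12 t01 u01 tu.
have [p [_ dp ep]] := @first_disagreement (greedy beta t) (greedy beta u) k0 dk.
have [ei [it iu]] := insert_010_agree N0 ep.
move: ei it iu; set q := (p %/ N)%N; set i := (q * _ + _)%N => ei it iu.
have ext := @sparse_point_expansion _ n N _ _ b12 n1 h1 t01.
have exu := @sparse_point_expansion _ n N _ _ b12 n1 h1 u01.
have nt := @insert_010_no_run n N _ n1 (greedy_no_run b12 h1 t01).
have nu := @insert_010_no_run n N _ n1 (greedy_no_run b12 h1 u01).
(* The one needed for the separation comes within the next [N + 3] digits. *)
have sep : beta ^- (i.+1 + (N + 3)) <= `|sparse_point beta N t - sparse_point beta N u|.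
  have [gt|gt] := boolP (greedy beta t p).
    apply: le_trans (ler_norm _).
    apply: (expansion_sep b1 h1 nu (insert_010_dense N _) ext exu ei); first by rewrite it.
    by rewrite iu; move: dp; rewrite gt; case: (greedy beta u p).
  rewrite distrC; apply: le_trans (ler_norm _).
  apply: (expansion_sep b1 h1 nt (insert_010_dense N _) exu ext); last by rewrite it.
    by move=> j ji; rewrite ei.
  by rewrite iu; move: dp; rewrite (negbTE gt); case: (greedy beta u p).
apply: (le_trans (greedy_dist b12 t01 u01 ep)).
(* Both exponents are rounded to whole groups: [q * N <= p], and
   [i.+1 + (N + 3)] is at most [q + 2] groups of [N + 3] digits. *)
apply: (@le_trans _ _ (beta ^+ (2 * N) * beta ^- ((q + 2) * N))).
  rewrite mulnDl addnC exprD invfM mulVKf ?expf_neq0 ?lt0r_neq0//.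
  rewrite lef_pV2 ?posrE ?exprn_gt0// ler_weXn2l ?(ltW b1)//.
  exact: leq_trunc_div.
rewrite ler_pM2l ?exprn_gt0//; apply: (le_trans (powR_ratio (q + 2) b1 sN)).
apply: ge0_ler_powR; rewrite ?nnegrE ?invr_ge0 ?exprn_ge0 ?(ltW b0)//.
apply: le_trans sep; rewrite lef_pV2 ?posrE ?exprn_gt0// ler_weXn2l ?(ltW b1)//.
have := ltn_pmod p N0; rewrite /i mulnDl; move: (q * _)%N (p %% N)%N => Q r.
by clear; lia.
Qed.

Theorem theorem1p1 (R : realType) (n : nat) (hn : (2 <= n)%N) (beta : R)
    (hbeta : 1 < beta < 2) (hroot : beta ^+ n = \sum_(i < n) beta ^+ i) :
  hausdorff_dim (no_universal_expansion beta) = 1%E.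
Proof.
have b0 : 0 < beta by lra.
have h1 := sum_inv_powers (lt0r_neq0 b0) hroot.
have c0 : 0 <= (beta - 1)^-1 by rewrite invr_ge0; lra.
apply: (@hausdorff_dim_eq1 _ _ (Num.trunc (beta - 1)^-1).+1) => [x [/andP[x0 xc] _] /=|s s01].
  by rewrite x0 (le_trans xc)// ltW//; have /andP[] := truncn_itv c0.
(* The condition [s * (N + 3) <= N] solved for [N]. *)
pose y : R := 3 * s / (1 - s).
have y0 : 0 <= y by rewrite divr_ge0; lra.
have /andP[_] := truncn_itv y0; set N := (Num.trunc y).+1 => yN.
apply: (@hausdorff_measure_holder_neq0 _ s (beta ^+ (2 * N)) (sparse_point beta N)).
- by case/andP: s01.
- by rewrite exprn_gt0.
- by move=> t t01; apply: (sparse_point_no_universal N hbeta hn hroot t01).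
move=> t u t01 u01; apply: (sparse_point_holder hbeta hn h1 _ _ _ t01 u01) => //.
  by case/andP: s01.
have : y * (1 - s) <= N%:R * (1 - s) by rewrite ler_wpM2r ?(ltW yN)//; lra.
rewrite /y divfK; last by apply: lt0r_neq0; lra.
rewrite natrD; lra.
Qed.
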